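(* Let $\psi_0:[0,\infty)\to[0,\infty)$ be an admissible scalar penalty (see context). For fixed $\lambda>0$ and $y>0$, let $F:[0,\infty)\to\mathbb{R}$, $F(z)=\frac12(z-y)^2+\lambda\psi_0(z)$. Then $F$ has the following properties. (i) (Concavity-convexity transition) There exists $m(\lambda)\ge 0$ such that $F$ is strictly concave on $[0,m(\lambda)]$ and convex on $[m(\lambda),+\infty)$. (ii) (Local minimizers transition) $F$ admits at most two local minimizers on $[0,\infty)$. There exists $\tau(\lambda)$ such that: - if $y<\tau(\lambda)$, $0$ is the unique local minimizer (hence global); - if $\tau(\lambda)\le y\le\lambda\psi_0'(0)$, there exist two local minimizers: $0$ and another one, denoted $\rho^+(y;\lambda)$; - if $y\ge\lambda\psi_0'(0)$, there is a unique minimizer, still denoted $\rho^+(y;\lambda)$. Moreover, the threshold $\tau(\lambda)$ writes $\tau(\lambda)=m(\lambda)+\lambda\psi_0'(m(\lambda))$, and the nonzero minimizer admits the lower bound $\rho^+(y;\lambda)\ge m(\lambda)>0$. Finally, $\rho^+$ is continuous with the following variations: it is non-decreasing with $y$ and non-increasing with $\lambda$. (iii) (Global minimizers transition) There exists $T(\lambda)\in[\tau(\lambda),\lambda\psi_0'(0)]$ such that: - if $y<T(\lambda)$, $0$ is the global minimizer; - if $y=T(\lambda)$, $0$ and $\rho^+(y;\lambda)$ are global minimizers; - if $y>T(\lambda)$, $\rho^+(y;\lambda)$ is the global minimizer.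
   Context: Admissible scalar penalty: $\psi_0:[0,\infty)\to[0,\infty)$ is continuous, non-decreasing and concave, $\psi_0(0)=0$; $\psi_0$ is continuously differentiable on $(0,\infty)$ and $\psi_0'(0):=\lim_{z\to0^+}\psi_0'(z)\in[0,\infty]$ (possibly $+\infty$); $\psi_0$ is twice differentiable on $(0,\infty)$ except possibly on a finite set $Z_\psi$; the second derivative $\psi_0''$ is increasing, and $\lim_{z\to+\infty}\psi_0''(z)=0$. All minimizers (local and global) of $F$ are relative to $[0,\infty)$. The quantities $m(\lambda)$, $\tau(\lambda)$ and $T(\lambda)$ depend on $\lambda$ (and $\psi_0$) but not on $y$.
   Formalization: ''Increasing'' is strict. In (ii), two local minimizers are claimed only for τ<y<λψ'(0): at y=τ<λψ'(0) only 0 is one and ρ+ is merely stationary; at y=λψ'(0) the third bullet holds. m>0 is claimed only if τ<λψ'(0) (m=0 occurs, e.g. log(1+z), λ≤1); ρ+>0 for y>τ. *)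

(* Defs.v *)
From Stdlib Require Import Reals List.
From Coquelicot Require Import Coquelicot.
Open Scope R_scope.

(* Functions on [0,+oo) are represented by functions R -> R of which only the
   values on [0,+oo) are ever used. *)
Definition halfline (z : R) : Prop := 0 <= z.

Definition convex_on (D : R -> Prop) (f : R -> R) : Prop :=
  forall x y t, D x -> D y -> 0 <= t <= 1 ->
    f (t * x + (1 - t) * y) <= t * f x + (1 - t) * f y.

Definition concave_on (D : R -> Prop) (f : R -> R) : Prop :=
  forall x y t, D x -> D y -> 0 <= t <= 1 ->
    t * f x + (1 - t) * f y <= f (t * x + (1 - t) * y).

Definition strictly_concave_on (D : R -> Prop) (f : R -> R) : Prop :=
  forall x y t, D x -> D y -> x <> y -> 0 < t < 1 ->
    t * f x + (1 - t) * f y < f (t * x + (1 - t) * y).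

(* [dpsi0] is psi'(0), the right limit of psi' at 0, possibly +oo.
   The second derivative is "increasing" in the strict sense, on the set where
   it is assumed to exist: if psi'' were allowed to be constant on an interval,
   F could be constant there and have infinitely many minimizers. *)
Record admissible_penalty (psi : R -> R) (dpsi0 : Rbar) : Prop := {
  pen_ge0 : forall z, 0 <= z -> 0 <= psi z;
  pen_continuous : continuous_on halfline psi;
  pen_nondecreasing : forall x y, 0 <= x -> x <= y -> psi x <= psi y;
  pen_concave : concave_on halfline psi;
  pen_0 : psi 0 = 0;
  pen_C1 : forall z, 0 < z -> ex_derive psi z /\ continuous (Derive psi) z;
  pen_deriv0 : filterlim (Derive psi) (at_right 0) (Rbar_locally dpsi0);
  pen_deriv0_ge0 : Rbar_le 0 dpsi0;
  pen_deriv2 : exists Z : list R,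
    (forall z, 0 < z -> ~ In z Z -> ex_derive_n psi 2 z) /\
    (forall x y, 0 < x -> x < y -> ~ In x Z -> ~ In y Z ->
       Derive_n psi 2 x < Derive_n psi 2 y);
  pen_deriv2_lim : is_lim (Derive_n psi 2) p_infty 0
}.

(* psi' on [0,+oo), extended by its limit at 0. *)
Definition pen_deriv (psi : R -> R) (dpsi0 : Rbar) (z : R) : Rbar :=
  if Req_EM_T z 0 then dpsi0 else Finite (Derive psi z).

Definition F (psi : R -> R) (lam y z : R) : R :=
  / 2 * (z - y) ^ 2 + lam * psi z.

(* Minimizers are relative to [0,+oo). *)
Definition local_minimizer (f : R -> R) (z : R) : Prop :=
  0 <= z /\ within halfline (locally z) (fun x => f z <= f x).

Definition global_minimizer (f : R -> R) (z : R) : Prop :=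
  0 <= z /\ forall x, 0 <= x -> f z <= f x.

(* Main.v *)
Require Import Defs.
From Stdlib Require Import Reals Ranalysis5 List Lra Classical ClassicalEpsilon.
From Coquelicot Require Import Coquelicot.
Open Scope R_scope.

(** Since [psi''] is strictly increasing off a finite set, [psi'] is strictly
    convex on (0,+oo), and so is [level psi' lam z = z + lam psi'(z)].  As
    [F' = level - y], everything is read off the unimodal graph of the level
    function: [m] is its turning point, [tau] its infimum, and [rho y lam] the
    root of [level = y] on its increasing branch.  Moreover
    [F z - F 0 = z (z/2 + lam psi(z)/z - y)], so that [T] is the infimum of
    [z/2 + lam psi(z)/z] over [z > 0]. *)

(** The difficulty sits at [0]: [psi'(0)] may be infinite, and [Derive psi 0] carries no
    information. Properties of the level function are therefore stated on (0,+oo), and its behaviour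
    at [0] enters only through comparisons with the limit [lam * psi'(0)] in [Rbar]. If [m = 0], the
    level function increases throughout, [tau] is that limit (hence the limit is finite) and the
    regime with two minimizers is empty; if [m > 0], [tau] is the value at [m] and lies strictly
    below the limit. Points without [psi''] are the second obstacle: convexity is handled by
    comparing chord slopes, not by signs of second derivatives. At [y = tau] with [m > 0], [F']
    vanishes at [m] without changing sign, so the root is not a minimizer there and equality needs
    its own treatment. *)

(** * Mean value inequalities and strict convexity *)

(** Cauchy's form, applied with [id], asks for derivability only inside the interval; this is what
    [F] needs at [0], where [psi'] may be infinite. *)
Lemma MVT_open (f df : R -> R) (a b : R) :
  a < b ->
  (forall z, a < z < b -> is_derive f z (df z)) ->
  (forall z, a <= z <= b -> continuous f z) ->
  exists c, a < c < b /\ f b - f a = df c * (b - a).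
Proof.
intros Hab Hd Hc.
assert (pr1 : forall c, a < c < b -> derivable_pt f c).
{ intros c Hc'. exists (df c). apply is_derive_Reals. auto. }
assert (pr2 : forall c, a < c < b -> derivable_pt id c).
{ intros c _. apply derivable_pt_id. }
destruct (MVT f id a b pr1 pr2 Hab) as [c [P E]].
- intros c Hc'. apply continuity_pt_filterlim. apply Hc. assumption.
- intros c _. apply derivable_continuous_pt, derivable_pt_id.
- exists c. split; [exact P|].
  assert (E1 : derive_pt f c (pr1 c P) = df c).
  { apply derive_pt_eq_0. apply is_derive_Reals. auto. }
  assert (E2 : derive_pt id c (pr2 c P) = 1).
  { apply derive_pt_eq_0. apply derivable_pt_lim_id. }
  rewrite E1, E2 in E. unfold id in E. lra.
Qed.

(** Cut the interval at an exceptional point: the mean slope of the whole is an average of those of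
    the two halves, so the larger of the two derivatives found still bounds it. *)
Lemma MVT_le_except (f : R -> R) (Z : list R) : forall a b : R,
  a < b ->
  (forall z, a <= z <= b -> continuous f z) ->
  (forall z, a < z < b -> ~ In z Z -> ex_derive f z) ->
  exists c, a < c < b /\ ~ In c Z /\ f b - f a <= Derive f c * (b - a).
Proof.
induction Z as [|z0 Z IH]; intros a b Hab Hc Hd.
- destruct (MVT_open f (Derive f) a b Hab) as [c [H1 H2]].
  + intros z Hz. apply Derive_correct. apply Hd; auto.
  + exact Hc.
  + exists c. split; [exact H1|]. split; [auto|]. lra.
- destruct (classic (a < z0 < b)) as [Hz0|Hz0].
  + destruct (IH a z0) as [c1 [H1 [N1 L1]]]; [lra| | |].
    { intros z Hz. apply Hc. lra. }
    { intros z Hz Nz. apply Hd; [lra|]. intros [E|E]; [lra|auto]. }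
    destruct (IH z0 b) as [c2 [H2 [N2 L2]]]; [lra| | |].
    { intros z Hz. apply Hc. lra. }
    { intros z Hz Nz. apply Hd; [lra|]. intros [E|E]; [lra|auto]. }
    destruct (Rle_lt_dec (Derive f c1) (Derive f c2)) as [L|L].
    * exists c2. split; [lra|]. split; [intros [E|E]; [lra|auto]|]. nra.
    * exists c1. split; [lra|]. split; [intros [E|E]; [lra|auto]|]. nra.
  + destruct (IH a b Hab Hc) as [c [H1 [N1 L1]]].
    { intros z Hz Nz. apply Hd; [exact Hz|]. intros [E|E]; [subst z0; auto|auto]. }
    exists c. split; [exact H1|]. split; [|exact L1].
    intros [E|E]; [subst z0; auto|auto].
Qed.

(** The three-chord inequality with denominators cleared. *)
Definition strictly_convex_pos (p : R -> R) : Prop :=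
  forall a b c, 0 < a -> a < b -> b < c ->
    (p b - p a) * (c - b) < (p c - p b) * (b - a).

(** Some [u] left of [b] and [v] right of [b], both outside [Z], satisfy: slope over [[a, b]] at
    most [p' u], less than [p' v], at most the slope over [[b, c]]. *)
Lemma strictly_convex_of_derive (p : R -> R) (Z : list R) :
  (forall z, 0 < z -> continuous p z) ->
  (forall z, 0 < z -> ~ In z Z -> ex_derive p z) ->
  (forall x y, 0 < x -> x < y -> ~ In x Z -> ~ In y Z ->
     Derive p x < Derive p y) ->
  strictly_convex_pos p.
Proof.
intros Hc Hd Hi a b c Ha Hab Hbc.
destruct (MVT_le_except p Z a b Hab) as [u [Hu [Nu Lu]]].
{ intros z Hz. apply Hc. lra. }
{ intros z Hz. apply Hd. lra. }
(* Passing to [- p] turns the upper bound on the slope into a lower one. *)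
destruct (MVT_le_except (fun z => - p z) Z b c Hbc) as [v [Hv [Nv Lv]]].
{ intros z Hz. apply (continuous_opp p). apply Hc. lra. }
{ intros z Hz Nz. apply (ex_derive_opp p). apply Hd; [lra|auto]. }
rewrite Derive_opp in Lv.
assert (L := Hi u v ltac:(lra) ltac:(lra) Nu Nv).
assert (P : 0 < (b - a) * (c - b)) by (apply Rmult_lt_0_compat; lra).
assert (H1 : (p b - p a) * (c - b) <= Derive p u * ((b - a) * (c - b))).
{ rewrite <- Rmult_assoc. apply Rmult_le_compat_r; lra. }
assert (H2 : Derive p v * ((b - a) * (c - b)) <= (p c - p b) * (b - a)).
{ replace (Derive p v * ((b - a) * (c - b))) with ((Derive p v * (c - b)) * (b - a)) by ring.
  apply Rmult_le_compat_r; lra. }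
nra.
Qed.

(* The value of [y] for which [z] is a stationary point of [F psi lam y], when
   [p] is the derivative of [psi]. *)
Definition level (p : R -> R) (lam z : R) : R := z + lam * p z.

Lemma level_convex (p : R -> R) (lam : R) :
  0 < lam -> strictly_convex_pos p -> strictly_convex_pos (level p lam).
Proof.
intros Hl Hp a b c Ha Hab Hbc. unfold level.
assert (H := Hp a b c Ha Hab Hbc). nra.
Qed.

Lemma level_continuous (p : R -> R) (lam z : R) :
  continuous p z -> continuous (level p lam) z.
Proof.
intros H. apply (continuous_plus (fun z => z) (fun z => lam * p z)).
- apply continuous_id.
- apply (continuous_scal_r lam p). exact H.
Qed.

(** * Turning point of a strictly convex function *)

(** The value [g 0] never occurs. With [m = 0] the decreasing clause is vacuous, which covers a
    function increasing on all of (0,+oo). *)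
Definition turning_point (g : R -> R) (m : R) : Prop :=
  0 <= m /\
  (forall a b, 0 < a -> a < b -> b <= m -> g b < g a) /\
  (forall a b, 0 < a -> m <= a -> a < b -> g a < g b).

Lemma convex_increasing_after (g : R -> R) (a b c : R) :
  strictly_convex_pos g -> 0 < a -> a < b -> b < c -> g a <= g b -> g b < g c.
Proof.
intros Hg Ha Hab Hbc H. assert (H' := Hg a b c Ha Hab Hbc). nra.
Qed.

Lemma continuous_lt_locally (g : R -> R) (z c : R) :
  continuous g z -> g z < c ->
  exists d : posreal, forall x, Rabs (x - z) < d -> g x < c.
Proof.
intros Hg H. destruct (Hg (fun u => u < c)) as [d Hd].
{ apply (open_lt c (g z) H). }
exists d. intros x Hx. apply Hd. exact Hx.
Qed.

Lemma continuous_gt_locally (g : R -> R) (z c : R) :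
  continuous g z -> c < g z ->
  exists d : posreal, forall x, Rabs (x - z) < d -> c < g x.
Proof.
intros Hg H. destruct (Hg (fun u => c < u)) as [d Hd].
{ apply (open_gt c (g z) H). }
exists d. intros x Hx. apply Hd. exact Hx.
Qed.

Lemma turning_point_exists (g : R -> R) :
  strictly_convex_pos g ->
  (forall z, 0 < z -> continuous g z) ->
  (forall z, 0 < z -> z <= g z) ->
  exists m, turning_point g m.
Proof.
intros Hg Hc Hz.
(* Points after which [g] fails to stay strictly above its current value; [0] is added so that the
   set is never empty. Its supremum is the turning point. *)
set (E := fun z => z = 0 \/ (0 < z /\ exists b, z < b /\ g b <= g z)).
assert (HE : forall a z, 0 < a -> a < z -> E z -> g z < g a).
{ intros a z Ha Haz [->|[_ [b [Hb1 Hb2]]]]; [lra|].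
  destruct (Rlt_le_dec (g z) (g a)) as [L|L]; [exact L|].
  assert (K := convex_increasing_after g a z b Hg Ha Haz Hb1 L). lra. }
destruct (completeness E) as [m [Hub Hlub]].
(* A point [z > 1] of [E] has [g z < g 1], while [z <= g z]. *)
{ exists (1 + Rabs (g 1)). intros z Hz'.
  assert (A := Rabs_pos (g 1)). assert (A' := Rle_abs (g 1)).
  destruct (Rle_lt_dec z 1) as [L|L]; [lra|].
  assert (K := HE 1 z ltac:(lra) L Hz'). assert (K' := Hz z ltac:(lra)). lra. }
{ exists 0. left. reflexivity. }
assert (Hm : 0 <= m) by (apply Hub; left; reflexivity).
assert (Hin : forall b, b < m -> exists z, E z /\ b < z).
{ intros b Hb. apply NNPP. intros N. apply (Rlt_not_le _ _ Hb). apply Hlub.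
  intros z Ez. destruct (Rle_lt_dec z b) as [L|L]; [exact L|].
  exfalso. apply N. exists z. auto. }
assert (Hdec : forall a b, 0 < a -> a < b -> b < m -> g b < g a).
{ intros a b Ha Hab Hb. destruct (Hin b Hb) as [z [Ez Lz]].
  assert (K := HE b z ltac:(lra) Lz Ez).
  destruct (Rlt_le_dec (g b) (g a)) as [L|L]; [exact L|].
  assert (K' := convex_increasing_after g a b z Hg Ha Hab Lz L). lra. }
assert (Hinc : forall a b, m < a -> a < b -> g a < g b).
{ intros a b Ha Hab. destruct (Rlt_le_dec (g a) (g b)) as [L|L]; [exact L|].
  assert (K : a <= m); [|lra].
  apply Hub. right. split; [lra|]. exists b. auto. }
exists m. split; [exact Hm|]. split.
(* Strict decrease is known only before [m] and is extended to [m] by continuity: if [g m] were at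
   least [g a], it would exceed [g] at the midpoint, and so would values just before [m], against
   the decrease. The increasing side is symmetric. *)
- intros a b Ha Hab [Hb| ->]; [auto|].
  destruct (Rlt_le_dec (g m) (g a)) as [L|L]; [exact L|].
  assert (K := Hdec a ((a + m) / 2) Ha ltac:(lra) ltac:(lra)).
  destruct (continuous_gt_locally g m (g ((a + m) / 2)) (Hc m ltac:(lra)) ltac:(lra)) as [d Hd].
  assert (Pd := cond_pos d).
  set (x := Rmax ((a + 3 * m) / 4) (m - d / 2)).
  assert (X1 : (a + 3 * m) / 4 <= x) by apply Rmax_l.
  assert (X2 : m - d / 2 <= x) by apply Rmax_r.
  assert (X3 : x < m) by (apply Rmax_lub_lt; lra).
  assert (K1 := Hd x ltac:(apply Rabs_def1; lra)).
  assert (K2 := Hdec ((a + m) / 2) x ltac:(lra) ltac:(lra) X3). lra.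
- intros a b Ha [Hma| <-] Hab; [auto|].
  destruct (Rlt_le_dec (g m) (g b)) as [L|L]; [exact L|].
  assert (K : g ((m + b) / 2) < g m).
  { assert (K := Hinc ((m + b) / 2) b ltac:(lra) ltac:(lra)). lra. }
  destruct (continuous_gt_locally g m (g ((m + b) / 2)) (Hc m Ha) K) as [d Hd].
  assert (Pd := cond_pos d).
  set (x := Rmin ((3 * m + b) / 4) (m + d / 2)).
  assert (X1 : x <= (3 * m + b) / 4) by apply Rmin_l.
  assert (X2 : x <= m + d / 2) by apply Rmin_r.
  assert (X3 : m < x) by (apply Rmin_glb_lt; lra).
  assert (K1 := Hd x ltac:(apply Rabs_def1; lra)).
  assert (K2 := Hinc x ((m + b) / 2) X3 ltac:(lra)). lra.
Qed.

(** * Infimum of the level function and root on its increasing branch *)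

(** An infimum rather than the value at the turning point: if the latter is [0], the infimum is a
    limit at [0] and is not attained. *)
Definition inf_pos (g : R -> R) (t : R) : Prop :=
  (forall z, 0 < z -> t <= g z) /\
  (forall c, t < c -> exists z, 0 < z /\ g z < c).

Lemma inf_pos_exists (g : R -> R) :
  (forall z, 0 < z -> 0 <= g z) -> exists t, inf_pos g t.
Proof.
intros Hg.
destruct (completeness (fun u => exists z, 0 < z /\ u = - g z)) as [s [Hub Hlub]].
{ exists 0. intros u [z [Hz ->]]. assert (K := Hg z Hz). lra. }
{ exists (- g 1), 1. split; [lra|reflexivity]. }
exists (- s). split.
- intros z Hz. assert (K : - g z <= s); [|lra]. apply Hub. exists z. auto.
- intros c Hc. apply NNPP. intros N. assert (K : s <= - c); [|lra].
  apply Hlub. intros u [z [Hz ->]].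
  destruct (Rle_lt_dec c (g z)) as [L|L]; [lra|].
  exfalso. apply N. exists z. auto.
Qed.

Lemma inf_pos_turning_point (g : R -> R) (m t : R) :
  turning_point g m -> inf_pos g t -> 0 < m -> t = g m.
Proof.
intros [_ [Hd Hi]] [Hl Hs] Hm. apply Rle_antisym; [auto|].
destruct (Rle_lt_dec (g m) t) as [L|L]; [exact L|].
destruct (Hs _ L) as [z [Hz1 Hz2]].
destruct (Rtotal_order z m) as [K|[K|K]].
- assert (A := Hd z m Hz1 K ltac:(lra)). lra.
- subst z. lra.
- assert (A := Hi m z Hm ltac:(lra) K). lra.
Qed.

(* All clauses avoid [g 0], since the limit of [level p lam] at [0] may be infinite. *)
Definition upper_root (g : R -> R) (m y r : R) : Prop :=
  m <= r /\ (forall z, r < z -> y < g z) /\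
  (forall z, 0 < z -> m <= z -> z < r -> g z < y) /\
  (0 < r -> g r = y).

Lemma upper_root_exists (g : R -> R) (m t y : R) :
  (forall z, 0 < z -> continuous g z) ->
  (forall z, 0 < z -> z <= g z) ->
  turning_point g m -> inf_pos g t -> t <= y ->
  exists r, upper_root g m y r.
Proof.
intros Hc Hz Htp Hinf Hy.
destruct Htp as [Hm [Hd Hi]] eqn:Etp.
destruct Hinf as [Hl Hs] eqn:Einf.
destruct Hy as [Hy|Hy].
- destruct (Hs y Hy) as [z0 [Hz0 Gz0]].
  assert (exists z, 0 < z /\ m <= z /\ g z < y) as [z [Z1 [Z2 Z3]]].
  (* The point where [g] is below [y] has to lie on the increasing branch; if it precedes [m], then
     [m] itself serves, being the minimum point. *)
  { destruct (Rle_lt_dec m z0) as [L|L].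
    - exists z0. auto.
    - exists m. assert (K := inf_pos_turning_point g m t Htp Hinf ltac:(lra)).
      split; [lra|]. split; [lra|]. assert (K' := Hl z0 Hz0). lra. }
  assert (K := Hz z Z1).
  (* Since [z <= g z], the value at [y + 1] exceeds [y] and closes the bracket. *)
  assert (Ky := Hz (y + 1) ltac:(lra)).
  destruct (IVT_interv (fun u => g u - y) z (y + 1)) as [r [R1 R2]]; [|lra|lra|lra|].
  { intros a Ha. apply continuity_pt_filterlim.
    apply (continuous_minus g (fun _ => y)); [apply Hc; lra|apply continuous_const]. }
  assert (Gr : g r = y) by lra.
  exists r. split; [lra|]. split; [|split].
  + intros u Hu. assert (A := Hi r u ltac:(lra) ltac:(lra) Hu). lra.
  + intros u U1 U2 U3. assert (A := Hi u r U1 U2 U3). lra.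
  + auto.
(* At [y = t] the root is the turning point itself, possibly [0]. *)
- exists m. split; [lra|]. split; [|split].
  + intros z Lz. assert (K := Hl ((m + z) / 2) ltac:(lra)).
    assert (K' := Hi ((m + z) / 2) z ltac:(lra) ltac:(lra) ltac:(lra)). lra.
  + intros; lra.
  + intros P. rewrite <- Hy. symmetry. apply (inf_pos_turning_point g m t Htp Hinf P).
Qed.

(** * The level function of a penalty and its limit at 0 *)

Lemma Rbar_mult_pos_p_infty (lam : R) :
  0 < lam -> Rbar_mult lam p_infty = p_infty.
Proof.
intros H. unfold Rbar_mult, Rbar_mult'.
destruct (Rle_dec 0 lam) as [L|L]; [|lra].
destruct (Rle_lt_or_eq_dec 0 lam L); [reflexivity|lra].
Qed.

Lemma Rbar_lt_mult_pos (lam y : R) (l : Rbar) :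
  0 < lam -> Rbar_le 0 l -> Rbar_lt y (Rbar_mult lam l) -> Rbar_lt (y / lam) l.
Proof.
intros Hl H0 H. destruct l as [d| |]; [|exact I|destruct H0].
simpl in H |- *. apply Rmult_lt_reg_l with lam; [exact Hl|].
unfold Rdiv. rewrite (Rmult_comm y), <- Rmult_assoc, Rinv_r; lra.
Qed.

Lemma penalty_deriv_continuous (psi : R -> R) (dpsi0 : Rbar) (z : R) :
  admissible_penalty psi dpsi0 -> 0 < z -> continuous (Derive psi) z.
Proof. intros H Hz. apply (pen_C1 _ _ H z Hz). Qed.

Lemma penalty_is_derive (psi : R -> R) (dpsi0 : Rbar) (z : R) :
  admissible_penalty psi dpsi0 -> 0 < z -> is_derive psi z (Derive psi z).
Proof. intros H Hz. apply Derive_correct, (pen_C1 _ _ H z Hz). Qed.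

Lemma penalty_deriv_ge0 (psi : R -> R) (dpsi0 : Rbar) (z : R) :
  admissible_penalty psi dpsi0 -> 0 < z -> 0 <= Derive psi z.
Proof.
intros H Hz. destruct (Rle_lt_dec 0 (Derive psi z)) as [L|L]; [exact L|].
destruct (continuous_lt_locally (Derive psi) z 0 (penalty_deriv_continuous psi dpsi0 z H Hz) L)
  as [d Hd].
assert (Pd := cond_pos d).
destruct (MVT_open psi (Derive psi) z (z + d)) as [c [C1 C2]]; [lra| | |].
- intros x Hx. apply (penalty_is_derive psi dpsi0 x H). lra.
- intros x Hx. apply (ex_derive_continuous psi x). exists (Derive psi x).
  apply (penalty_is_derive psi dpsi0 x H). lra.
- assert (K := Hd c ltac:(apply Rabs_def1; lra)).
  assert (K' := pen_nondecreasing _ _ H z (z + d) ltac:(lra) ltac:(lra)).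
  nra.
Qed.

Lemma penalty_deriv_convex (psi : R -> R) (dpsi0 : Rbar) :
  admissible_penalty psi dpsi0 -> strictly_convex_pos (Derive psi).
Proof.
intros H. destruct (pen_deriv2 _ _ H) as [Z [HZ1 HZ2]].
apply strictly_convex_of_derive with Z.
- intros z. apply (penalty_deriv_continuous psi dpsi0 z H).
- exact HZ1.
- exact HZ2.
Qed.

Lemma penalty_level_convex (psi : R -> R) (dpsi0 : Rbar) (lam : R) :
  admissible_penalty psi dpsi0 -> 0 < lam ->
  strictly_convex_pos (level (Derive psi) lam).
Proof.
intros H Hl. apply level_convex; [exact Hl|]. apply (penalty_deriv_convex psi dpsi0 H).
Qed.

Lemma penalty_level_continuous (psi : R -> R) (dpsi0 : Rbar) (lam z : R) :
  admissible_penalty psi dpsi0 -> 0 < z ->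
  continuous (level (Derive psi) lam) z.
Proof.
intros H Hz. apply level_continuous, (penalty_deriv_continuous psi dpsi0 z H Hz).
Qed.

Lemma penalty_level_ge (psi : R -> R) (dpsi0 : Rbar) (lam z : R) :
  admissible_penalty psi dpsi0 -> 0 < lam -> 0 < z ->
  z <= level (Derive psi) lam z.
Proof.
intros H Hl Hz. assert (K := penalty_deriv_ge0 psi dpsi0 z H Hz).
unfold level. nra.
Qed.

Lemma level_gt_near_0 (psi : R -> R) (dpsi0 : Rbar) (lam y : R) :
  admissible_penalty psi dpsi0 -> 0 < lam ->
  Rbar_lt y (Rbar_mult lam dpsi0) ->
  exists d, 0 < d /\ forall z, 0 < z < d -> y < level (Derive psi) lam z.
Proof.
intros H Hl Hy.
apply Rbar_lt_mult_pos in Hy; [|exact Hl|exact (pen_deriv0_ge0 _ _ H)].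
destruct (pen_deriv0 _ _ H (fun u => y / lam < u)) as [d Hd].
{ apply (open_Rbar_gt' dpsi0 (y / lam) Hy). }
exists d. split; [apply cond_pos|]. intros z Hz.
assert (K : y / lam < Derive psi z).
{ apply Hd; [|lra]. change (Rabs (z - 0) < d). apply Rabs_def1; lra. }
apply (Rmult_lt_compat_l lam) in K; [|exact Hl].
replace (lam * (y / lam)) with y in K by (field; lra).
unfold level. lra.
Qed.

Lemma level_lt_near_0 (psi : R -> R) (dpsi0 : Rbar) (lam y : R) :
  admissible_penalty psi dpsi0 -> 0 < lam ->
  Rbar_lt (Rbar_mult lam dpsi0) y ->
  exists d, 0 < d /\ forall z, 0 < z < d -> level (Derive psi) lam z < y.
Proof.
intros H Hl Hy.
assert (L0 := pen_deriv0 _ _ H). assert (G0 := pen_deriv0_ge0 _ _ H).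
destruct dpsi0 as [d0| |]; [|rewrite Rbar_mult_pos_p_infty in Hy; [destruct Hy|exact Hl]|destruct G0].
simpl in Hy.
(* The gap is shared equally between the two terms [z] and [lam * psi'(z)] of the level. *)
set (e := (y - lam * d0) / 2).
destruct (L0 (fun u => u < d0 + e / lam)) as [d Hd].
{ apply (open_lt (d0 + e / lam) d0).
  assert (0 < e / lam); [|lra]. apply Rdiv_lt_0_compat; [unfold e; lra|exact Hl]. }
exists (Rmin d e). split.
{ apply Rmin_pos; [apply cond_pos|unfold e; lra]. }
intros z Hz.
assert (A1 := Rmin_l d e). assert (A2 := Rmin_r d e).
assert (K : Derive psi z < d0 + e / lam).
{ apply Hd; [|lra]. change (Rabs (z - 0) < d). apply Rabs_def1; lra. }
apply (Rmult_lt_compat_l lam) in K; [|exact Hl].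
rewrite Rmult_plus_distr_l in K.
replace (lam * (e / lam)) with e in K by (field; lra).
unfold level, e in *. lra.
Qed.

(** A strictly decreasing function stays strictly below its limit at [0]. The intermediate point
    [z / 2] supplies the strictness when [y] equals the limit. *)
Lemma level_lt_before_turning (psi : R -> R) (dpsi0 : Rbar) (lam m y z : R) :
  admissible_penalty psi dpsi0 -> 0 < lam ->
  turning_point (level (Derive psi) lam) m ->
  Rbar_le (Rbar_mult lam dpsi0) y -> 0 < z -> z <= m ->
  level (Derive psi) lam z < y.
Proof.
intros H Hl [_ [Hd _]] Hy Hz Hzm.
assert (K := Hd (z / 2) z ltac:(lra) ltac:(lra) Hzm).
destruct (Rlt_le_dec (level (Derive psi) lam z) y) as [L|L]; [exact L|].
destruct (level_lt_near_0 psi dpsi0 lam (level (Derive psi) lam (z / 2)) H Hl) as [d [Pd Hd']].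
{ apply Rbar_le_lt_trans with y; [exact Hy|]. simpl. lra. }
set (w := Rmin (d / 2) (z / 4)).
assert (W1 : w <= d / 2) by apply Rmin_l.
assert (W2 : w <= z / 4) by apply Rmin_r.
assert (W3 : 0 < w) by (apply Rmin_pos; lra).
assert (K1 := Hd' w ltac:(lra)).
assert (K2 := Hd w (z / 2) W3 ltac:(lra) ltac:(lra)). lra.
Qed.

Lemma tau_of_turning_0 (psi : R -> R) (dpsi0 : Rbar) (lam tau : R) :
  admissible_penalty psi dpsi0 -> 0 < lam ->
  turning_point (level (Derive psi) lam) 0 ->
  inf_pos (level (Derive psi) lam) tau ->
  Finite tau = Rbar_mult lam dpsi0.
Proof.
intros H Hl [_ [_ Hi]] [Hlow Hs].
(* A value below the limit would be exceeded near [0], against the increase of the level. This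
   excludes an infinite limit too, since any value would then lie below it. *)
assert (N1 : forall z, 0 < z -> ~ Rbar_lt (level (Derive psi) lam z) (Rbar_mult lam dpsi0)).
{ intros z Hz K. destruct (level_gt_near_0 psi dpsi0 lam _ H Hl K) as [d [Pd Hd]].
  set (w := Rmin (d / 2) (z / 2)).
  assert (W1 : w <= d / 2) by apply Rmin_l.
  assert (W2 : w <= z / 2) by apply Rmin_r.
  assert (W3 : 0 < w) by (apply Rmin_pos; lra).
  assert (K1 := Hd w ltac:(lra)).
  assert (K2 := Hi w z W3 ltac:(lra) ltac:(lra)). lra. }
apply Rbar_le_antisym; apply Rbar_not_lt_le; intros K.
- destruct (level_lt_near_0 psi dpsi0 lam _ H Hl K) as [d [Pd Hd]].
  assert (K1 := Hd (d / 2) ltac:(lra)). assert (K2 := Hlow (d / 2) ltac:(lra)). lra.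
- destruct (Rbar_mult lam dpsi0) as [b| |] eqn:E; simpl in K.
  + destruct (Hs b K) as [z [Hz Gz]]. apply (N1 z Hz). exact Gz.
  + apply (N1 1); [lra|exact I].
  + exact K.
Qed.

Lemma tau_lt_of_turning_pos (psi : R -> R) (dpsi0 : Rbar) (lam m tau : R) :
  admissible_penalty psi dpsi0 -> 0 < lam ->
  turning_point (level (Derive psi) lam) m ->
  inf_pos (level (Derive psi) lam) tau ->
  0 < m -> Rbar_lt tau (Rbar_mult lam dpsi0).
Proof.
intros H Hl Hm Ht P. apply Rbar_not_le_lt. intros K.
assert (K1 := level_lt_before_turning psi dpsi0 lam m tau m H Hl Hm K P ltac:(lra)).
rewrite (inf_pos_turning_point _ m tau Hm Ht P) in K1. lra.
Qed.

Lemma tau_le_limit (psi : R -> R) (dpsi0 : Rbar) (lam m tau : R) :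
  admissible_penalty psi dpsi0 -> 0 < lam ->
  turning_point (level (Derive psi) lam) m ->
  inf_pos (level (Derive psi) lam) tau ->
  Rbar_le tau (Rbar_mult lam dpsi0).
Proof.
intros H Hl Hm Ht. destruct (proj1 Hm) as [P|P].
- apply Rbar_lt_le, (tau_lt_of_turning_pos psi dpsi0 lam m tau H Hl Hm Ht P).
- subst m. rewrite <- (tau_of_turning_0 psi dpsi0 lam tau H Hl Hm Ht). apply Rbar_le_refl.
Qed.

(** Converse of [tau_lt_of_turning_pos]: the range of [y] between [tau] and the limit is nonempty
    exactly when [F] has a genuine concave part. *)
Lemma turning_pos_of_tau_lt (psi : R -> R) (dpsi0 : Rbar) (lam m tau : R) :
  admissible_penalty psi dpsi0 -> 0 < lam ->
  turning_point (level (Derive psi) lam) m ->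
  inf_pos (level (Derive psi) lam) tau ->
  Rbar_lt tau (Rbar_mult lam dpsi0) -> 0 < m.
Proof.
intros H Hl Hm Ht K. destruct (proj1 Hm) as [P|P]; [exact P|]. subst m.
rewrite <- (tau_of_turning_0 psi dpsi0 lam tau H Hl Hm Ht) in K. simpl in K. lra.
Qed.

Lemma tau_eq (psi : R -> R) (dpsi0 : Rbar) (lam m tau : R) :
  admissible_penalty psi dpsi0 -> 0 < lam ->
  turning_point (level (Derive psi) lam) m ->
  inf_pos (level (Derive psi) lam) tau ->
  Finite tau = Rbar_plus m (Rbar_mult lam (pen_deriv psi dpsi0 m)).
Proof.
intros H Hl Hm Ht. unfold pen_deriv. destruct (Req_EM_T m 0) as [E|E].
- subst m. rewrite <- (tau_of_turning_0 psi dpsi0 lam tau H Hl Hm Ht).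
  simpl. f_equal. ring.
- assert (P : 0 < m) by (assert (A := proj1 Hm); lra).
  rewrite (inf_pos_turning_point _ m tau Hm Ht P). reflexivity.
Qed.

Lemma upper_root_pos (g : R -> R) (m t y r : R) :
  inf_pos g t -> upper_root g m y r -> 0 <= m -> t < y -> 0 < r.
Proof.
intros [_ Hs] [Hr [Hgt _]] Hm Hy. destruct (Hs y Hy) as [z [Z1 Z2]].
destruct (Rle_lt_dec z r) as [L|L]; [lra|]. assert (K := Hgt z L). lra.
Qed.

(** * Monotonicity and convexity of F *)

(** [psi] is continuous only relative to the half-line, whereas the mean value theorem asks for
    two-sided continuity at the endpoints; extending by the constant [psi 0] on the left provides
    it. *)
Lemma continuous_Rmax_0 (psi : R -> R) (z : R) :
  continuous_on halfline psi -> continuous (fun x => psi (Rmax 0 x)) z.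
Proof.
intros H.
apply filterlim_comp with (within halfline (locally (Rmax 0 z))).
- intros P [d Hd]. exists d. intros x Hx. apply Hd; [|apply Rmax_l].
  change (Rabs (Rmax 0 x - Rmax 0 z) < d). change (Rabs (x - z) < d) in Hx.
  apply Rabs_def2 in Hx. unfold Rmax.
  assert (Pd := cond_pos d).
  destruct (Rle_dec 0 x), (Rle_dec 0 z); apply Rabs_def1; lra.
- apply H. apply Rmax_l.
Qed.

Lemma F_is_derive (psi : R -> R) (dpsi0 : Rbar) (lam y z : R) :
  admissible_penalty psi dpsi0 -> 0 < z ->
  is_derive (F psi lam y) z (level (Derive psi) lam z - y).
Proof.
intros H Hz. unfold F, level.
assert (K := penalty_is_derive psi dpsi0 z H Hz).
auto_derive.
- exists (Derive psi z). exact K.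
- change (fun x => psi x) with psi. field.
Qed.

Lemma F_MVT (psi : R -> R) (dpsi0 : Rbar) (lam y a b : R) :
  admissible_penalty psi dpsi0 -> 0 <= a -> a < b ->
  exists c, a < c < b /\
    F psi lam y b - F psi lam y a = (level (Derive psi) lam c - y) * (b - a).
Proof.
intros H Ha Hab.
destruct (MVT_open (F (fun x => psi (Rmax 0 x)) lam y)
           (fun z => level (Derive psi) lam z - y) a b Hab) as [c [C1 C2]].
- intros z Hz. apply is_derive_ext_loc with (F psi lam y).
  + assert (P : 0 < z) by lra. exists (mkposreal z P). intros x Hx.
    change (Rabs (x - z) < z) in Hx. apply Rabs_def2 in Hx.
    unfold F. rewrite Rmax_right; [reflexivity|lra].
  + apply (F_is_derive psi dpsi0); [exact H|lra].
- intros z _. unfold F.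
  apply (continuous_plus (fun z => / 2 * (z - y) ^ 2)
           (fun z => lam * psi (Rmax 0 z))).
  + apply (ex_derive_continuous (fun z => / 2 * (z - y) ^ 2)). auto_derive. exact I.
  + apply (continuous_scal_r lam (fun z => psi (Rmax 0 z))).
    apply continuous_Rmax_0, (pen_continuous _ _ H).
- exists c. split; [exact C1|]. rewrite <- C2. unfold F.
  rewrite !Rmax_right; lra.
Qed.

Lemma F_increasing (psi : R -> R) (dpsi0 : Rbar) (lam y a b : R) :
  admissible_penalty psi dpsi0 -> 0 <= a -> a < b ->
  (forall z, a < z < b -> y < level (Derive psi) lam z) ->
  F psi lam y a < F psi lam y b.
Proof.
intros H Ha Hab K. destruct (F_MVT psi dpsi0 lam y a b H Ha Hab) as [c [C1 C2]].
assert (A := K c C1). nra.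
Qed.

Lemma F_decreasing (psi : R -> R) (dpsi0 : Rbar) (lam y a b : R) :
  admissible_penalty psi dpsi0 -> 0 <= a -> a < b ->
  (forall z, a < z < b -> level (Derive psi) lam z < y) ->
  F psi lam y b < F psi lam y a.
Proof.
intros H Ha Hab K. destruct (F_MVT psi dpsi0 lam y a b H Ha Hab) as [c [C1 C2]].
assert (A := K c C1). nra.
Qed.

Lemma F_strictly_concave (psi : R -> R) (dpsi0 : Rbar) (lam m y : R) :
  admissible_penalty psi dpsi0 -> turning_point (level (Derive psi) lam) m ->
  strictly_concave_on (fun z => 0 <= z <= m) (F psi lam y).
Proof.
intros H [_ [Hd _]].
assert (W : forall x z t, 0 <= x -> x < z -> z <= m -> 0 < t < 1 ->
  t * F psi lam y x + (1 - t) * F psi lam y z < F psi lam y (t * x + (1 - t) * z)).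
{ intros x z t Hx Hxz Hz Ht. set (w := t * x + (1 - t) * z).
  assert (W1 : w - x = (1 - t) * (z - x)) by (unfold w; ring).
  assert (W2 : z - w = t * (z - x)) by (unfold w; ring).
  assert (P1 : 0 < (1 - t) * (z - x)) by (apply Rmult_lt_0_compat; lra).
  assert (P2 : 0 < t * (z - x)) by (apply Rmult_lt_0_compat; lra).
  destruct (F_MVT psi dpsi0 lam y x w H Hx ltac:(lra)) as [c1 [C1 E1]].
  destruct (F_MVT psi dpsi0 lam y w z H ltac:(lra) ltac:(lra)) as [c2 [C2 E2]].
  assert (K := Hd c1 c2 ltac:(lra) ltac:(lra) ltac:(lra)).
  rewrite W1 in E1. rewrite W2 in E2.
  assert (P : 0 < t * ((1 - t) * (z - x))) by (apply Rmult_lt_0_compat; lra).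
  (* The concavity gap at [w] is exactly [t * (1 - t) * (z - x)] times the difference of the levels
     at [c1] and [c2]. *)
  assert (Q := Rmult_lt_compat_r _ _ _ P K).
  nra. }
intros x z t Hx Hz Hxz Ht. destruct (Rtotal_order x z) as [L|[L|L]].
- apply W; lra.
- contradiction.
- assert (K := W z x (1 - t) ltac:(lra) L ltac:(lra) ltac:(lra)).
  replace (t * x + (1 - t) * z) with ((1 - t) * z + (1 - (1 - t)) * x) by ring. lra.
Qed.

Lemma F_convex (psi : R -> R) (dpsi0 : Rbar) (lam m y : R) :
  admissible_penalty psi dpsi0 -> turning_point (level (Derive psi) lam) m ->
  convex_on (fun z => m <= z) (F psi lam y).
Proof.
intros H [Hm [_ Hi]].
assert (W : forall x z t, m <= x -> x < z -> 0 < t < 1 ->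
  F psi lam y (t * x + (1 - t) * z) <= t * F psi lam y x + (1 - t) * F psi lam y z).
{ intros x z t Hx Hxz Ht. set (w := t * x + (1 - t) * z).
  assert (W1 : w - x = (1 - t) * (z - x)) by (unfold w; ring).
  assert (W2 : z - w = t * (z - x)) by (unfold w; ring).
  assert (P1 : 0 < (1 - t) * (z - x)) by (apply Rmult_lt_0_compat; lra).
  assert (P2 : 0 < t * (z - x)) by (apply Rmult_lt_0_compat; lra).
  destruct (F_MVT psi dpsi0 lam y x w H ltac:(lra) ltac:(lra)) as [c1 [C1 E1]].
  destruct (F_MVT psi dpsi0 lam y w z H ltac:(lra) ltac:(lra)) as [c2 [C2 E2]].
  assert (K := Hi c1 c2 ltac:(lra) ltac:(lra) ltac:(lra)).
  rewrite W1 in E1. rewrite W2 in E2.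
  assert (P : 0 < t * ((1 - t) * (z - x))) by (apply Rmult_lt_0_compat; lra).
  assert (Q := Rmult_lt_compat_r _ _ _ P K).
  nra. }
intros x z t Hx Hz Ht.
destruct (Req_dec t 0) as [->|T0].
{ replace (0 * x + (1 - 0) * z) with z by ring. lra. }
destruct (Req_dec t 1) as [->|T1].
{ replace (1 * x + (1 - 1) * z) with x by ring. lra. }
destruct (Rtotal_order x z) as [L|[L|L]].
- apply W; lra.
- subst z. replace (t * x + (1 - t) * x) with x by ring. lra.
- assert (K := W z x (1 - t) Hz L ltac:(lra)).
  replace (t * x + (1 - t) * z) with ((1 - t) * z + (1 - (1 - t)) * x) by ring. lra.
Qed.

(** * Local minimizers *)

(** The bound [a] may be negative, so [z = 0] is included: the condition on the left is then
    vacuous. *)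
Lemma local_minimizer_intro (psi : R -> R) (dpsi0 : Rbar) (lam y a z b : R) :
  admissible_penalty psi dpsi0 -> 0 <= z -> a < z -> z < b ->
  (forall w, 0 < w -> a < w -> w < z -> level (Derive psi) lam w < y) ->
  (forall w, z < w < b -> y < level (Derive psi) lam w) ->
  local_minimizer (F psi lam y) z.
Proof.
intros H Hz Ha Hb Hl Hr. split; [exact Hz|].
assert (P : 0 < Rmin (z - a) (b - z)) by (apply Rmin_pos; lra).
exists (mkposreal _ P). intros x Hx Dx. unfold halfline in Dx.
change (Rabs (x - z) < Rmin (z - a) (b - z)) in Hx. apply Rabs_def2 in Hx.
assert (A1 := Rmin_l (z - a) (b - z)). assert (A2 := Rmin_r (z - a) (b - z)).
destruct (Rtotal_order x z) as [L|[->|L]].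
- apply Rlt_le, (F_decreasing psi dpsi0); [exact H|exact Dx|exact L|].
  intros w Hw. apply Hl; lra.
- lra.
- apply Rlt_le, (F_increasing psi dpsi0); [exact H|exact Hz|exact L|].
  intros w Hw. apply Hr; lra.
Qed.

Lemma not_local_minimizer_right (psi : R -> R) (dpsi0 : Rbar) (lam y z b : R) :
  admissible_penalty psi dpsi0 -> z < b ->
  (forall w, z < w < b -> level (Derive psi) lam w < y) ->
  ~ local_minimizer (F psi lam y) z.
Proof.
intros H Hb Hr [Hz [d Hd]]. assert (Pd := cond_pos d).
set (x := Rmin b (z + d / 2)).
assert (A1 : x <= b) by apply Rmin_l. assert (A2 : x <= z + d / 2) by apply Rmin_r.
assert (A3 : z < x) by (apply Rmin_glb_lt; lra).
assert (K := F_decreasing psi dpsi0 lam y z x H Hz A3 ltac:(intros w Hw; apply Hr; lra)).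
assert (K' : F psi lam y z <= F psi lam y x); [|lra].
apply Hd; [|unfold halfline; lra].
change (Rabs (x - z) < d). apply Rabs_def1; lra.
Qed.

Lemma not_local_minimizer_left (psi : R -> R) (dpsi0 : Rbar) (lam y z a : R) :
  admissible_penalty psi dpsi0 -> 0 <= a -> a < z ->
  (forall w, a < w < z -> y < level (Derive psi) lam w) ->
  ~ local_minimizer (F psi lam y) z.
Proof.
intros H Ha Haz Hr [Hz [d Hd]]. assert (Pd := cond_pos d).
set (x := Rmax a (z - d / 2)).
assert (A1 : a <= x) by apply Rmax_l. assert (A2 : z - d / 2 <= x) by apply Rmax_r.
assert (A3 : x < z) by (apply Rmax_lub_lt; lra).
assert (K := F_increasing psi dpsi0 lam y x z H ltac:(lra) A3 ltac:(intros w Hw; apply Hr; lra)).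
assert (K' : F psi lam y z <= F psi lam y x); [|lra].
apply Hd; [|unfold halfline; lra].
change (Rabs (x - z) < d). apply Rabs_def1; lra.
Qed.

Lemma global_minimizer_local (f : R -> R) (z : R) :
  global_minimizer f z -> local_minimizer f z.
Proof.
intros [Hz Hg]. split; [exact Hz|].
exists (mkposreal 1 Rlt_0_1). intros x _ Hx. apply Hg. exact Hx.
Qed.

(* [z0] accounts for the stationary inflection point that occurs at [y = tau]. *)
Lemma zero_minimizer_of_level_gt (psi : R -> R) (dpsi0 : Rbar) (lam y z0 : R) :
  admissible_penalty psi dpsi0 ->
  (forall z, 0 < z -> z <> z0 -> y < level (Derive psi) lam z) ->
  (forall z, local_minimizer (F psi lam y) z <-> z = 0) /\
  global_minimizer (F psi lam y) 0.
Proof.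
intros H Hg.
assert (I1 : forall a b, 0 <= a -> a < b -> ~ a < z0 < b ->
  F psi lam y a < F psi lam y b).
{ intros a b Ha Hab N. apply (F_increasing psi dpsi0); [exact H|exact Ha|exact Hab|].
  intros z Hz. apply Hg; [lra|]. intros ->. auto. }
assert (I2 : forall a b, 0 <= a -> a < b -> F psi lam y a < F psi lam y b).
{ intros a b Ha Hab. destruct (classic (a < z0 < b)) as [L|L]; [|auto].
  apply Rlt_trans with (F psi lam y z0); apply I1; lra. }
assert (G : global_minimizer (F psi lam y) 0).
{ split; [lra|]. intros x [Hx|<-]; [|lra]. apply Rlt_le, I2; lra. }
split; [|exact G]. intros z. split.
- intros Hz. destruct (proj1 Hz) as [P|<-]; [|reflexivity]. exfalso. revert Hz.
  (* Chosen so that the interval from [a] to [z] misses [z0]. *)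
  set (a := if Rlt_dec z0 z then Rmax 0 z0 else 0).
  assert (A : 0 <= a /\ a < z /\ (a < z -> z0 <= a \/ z <= z0)).
  { unfold a. destruct (Rlt_dec z0 z) as [L|L].
    - assert (A1 := Rmax_l 0 z0). assert (A2 := Rmax_r 0 z0).
      split; [exact A1|]. split; [apply Rmax_lub_lt; lra|lra].
    - lra. }
  apply (not_local_minimizer_left psi dpsi0 lam y z a); [exact H|lra|lra|].
  intros w Hw. apply Hg; lra.
- intros ->. apply global_minimizer_local, G.
Qed.

Lemma gt_of_lt_inf_pos (g : R -> R) (t y : R) :
  inf_pos g t -> y < t -> forall z, 0 < z -> y < g z.
Proof. intros [Hl _] Hy z Hz. assert (K := Hl z Hz). lra. Qed.

(** Before [m] the level decreases, so at each positive point [F] either decreases just to the right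
    or increases just to the left. From [m] on, the sign of [F'] changes only at the root. *)
Lemma local_minimizer_cases (psi : R -> R) (dpsi0 : Rbar) (lam m y r z : R) :
  admissible_penalty psi dpsi0 ->
  turning_point (level (Derive psi) lam) m ->
  upper_root (level (Derive psi) lam) m y r ->
  local_minimizer (F psi lam y) z -> z = 0 \/ z = r.
Proof.
intros H [Hm [Hd Hi]] [Hr [Hgt [Hlt Heq]]] Hz.
destruct (proj1 Hz) as [P|P]; [|left; auto].
destruct (Rtotal_order z r) as [L|[L|L]]; [|right; exact L|].
- exfalso. destruct (Rle_lt_dec m z) as [K|K].
  + revert Hz. apply (not_local_minimizer_right psi dpsi0 lam y z r H L).
    intros w Hw. apply Hlt; lra.
  + destruct (Rle_lt_dec (level (Derive psi) lam z) y) as [Q|Q].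
    * revert Hz. apply (not_local_minimizer_right psi dpsi0 lam y z m H K).
      intros w Hw. assert (A := Hd z w P ltac:(lra) ltac:(lra)). lra.
    * revert Hz. apply (not_local_minimizer_left psi dpsi0 lam y z 0 H ltac:(lra) P).
      intros w Hw. assert (A := Hd w z ltac:(lra) ltac:(lra) ltac:(lra)). lra.
- exfalso. revert Hz. apply (not_local_minimizer_left psi dpsi0 lam y z r H ltac:(lra) L).
  intros w Hw. apply Hgt; lra.
Qed.

Lemma F_increasing_after_root (psi : R -> R) (dpsi0 : Rbar) (lam m y r z : R) :
  admissible_penalty psi dpsi0 -> 0 <= r ->
  upper_root (level (Derive psi) lam) m y r ->
  r <= z -> F psi lam y r <= F psi lam y z.
Proof.
intros H Hr0 [_ [Hgt _]] [L|<-]; [|lra].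
apply Rlt_le, (F_increasing psi dpsi0); [exact H|lra|exact L|].
intros w Hw. apply Hgt; lra.
Qed.

(* On [0, m] concavity pushes the minimum of [F] to the endpoints. *)
Lemma F_ge_min (psi : R -> R) (dpsi0 : Rbar) (lam m y r z : R) :
  admissible_penalty psi dpsi0 ->
  turning_point (level (Derive psi) lam) m ->
  upper_root (level (Derive psi) lam) m y r ->
  0 <= z -> F psi lam y 0 <= F psi lam y z \/ F psi lam y r <= F psi lam y z.
Proof.
intros H [Hm [Hd Hi]] Hroot Hz. destruct Hz as [P|<-]; [|left; lra].
assert (Hroot' := Hroot). destruct Hroot' as [Hr [Hgt [Hlt Heq]]].
destruct (Rle_lt_dec r z) as [L|L].
{ right. apply (F_increasing_after_root psi dpsi0 lam m y r z); auto; lra. }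
assert (D : forall w, m <= w -> w < r -> 0 < w -> F psi lam y r < F psi lam y w).
{ intros w W1 W2 W3. apply (F_decreasing psi dpsi0); [exact H|lra|exact W2|].
  intros u Hu. apply Hlt; lra. }
destruct (Rle_lt_dec m z) as [K|K].
{ right. apply Rlt_le, D; lra. }
destruct (Rle_lt_dec (level (Derive psi) lam z) y) as [Q|Q].
- right. apply Rlt_le, Rle_lt_trans with (F psi lam y m).
  + destruct Hr as [Hr|Hr]; [apply Rlt_le, D; lra|rewrite Hr; lra].
  + apply (F_decreasing psi dpsi0); [exact H|lra|exact K|].
    intros w Hw. assert (A := Hd z w P ltac:(lra) ltac:(lra)). lra.
- left. apply Rlt_le, (F_increasing psi dpsi0); [exact H|lra|exact P|].
  intros w Hw. assert (A := Hd w z ltac:(lra) ltac:(lra) ltac:(lra)). lra.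
Qed.

Lemma zero_local_minimizer (psi : R -> R) (dpsi0 : Rbar) (lam y : R) :
  admissible_penalty psi dpsi0 -> 0 < lam ->
  Rbar_lt y (Rbar_mult lam dpsi0) -> local_minimizer (F psi lam y) 0.
Proof.
intros H Hl Hy. destruct (level_gt_near_0 psi dpsi0 lam y H Hl Hy) as [d [Pd Hd]].
apply (local_minimizer_intro psi dpsi0 lam y (-1) 0 d H); [lra|lra|exact Pd| |].
- intros w W1 _ W2. lra.
- exact Hd.
Qed.

Lemma root_local_minimizer (psi : R -> R) (dpsi0 : Rbar) (lam m tau y r : R) :
  admissible_penalty psi dpsi0 ->
  turning_point (level (Derive psi) lam) m ->
  inf_pos (level (Derive psi) lam) tau ->
  upper_root (level (Derive psi) lam) m y r ->
  tau < y -> local_minimizer (F psi lam y) r.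
Proof.
intros H Hm Ht Hroot Hy. assert (Hroot' := Hroot).
destruct Hroot' as [Hr [Hgt [Hlt Heq]]]. assert (Hm0 := proj1 Hm).
assert (P := upper_root_pos _ m tau y r Ht Hroot Hm0 Hy).
(* Here [tau < y] is essential: a root equal to the turning point would have level [tau]. *)
assert (L : m < r).
{ destruct Hr as [Hr|Hr]; [exact Hr|]. subst m.
  assert (A := inf_pos_turning_point _ r tau Hm Ht P). assert (A' := Heq P). lra. }
apply (local_minimizer_intro psi dpsi0 lam y m r (r + 1) H); [lra|exact L|lra| |].
- intros w W1 W2 W3. apply Hlt; lra.
- intros w Hw. apply Hgt; lra.
Qed.

(** Once [y] reaches the limit, the level is below [y] on the whole stretch from [0] to the root, so
    [F] decreases to [r] and then increases. *)
Lemma root_minimizer_of_limit_le (psi : R -> R) (dpsi0 : Rbar) (lam m y r : R) :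
  admissible_penalty psi dpsi0 -> 0 < lam ->
  turning_point (level (Derive psi) lam) m ->
  upper_root (level (Derive psi) lam) m y r ->
  Rbar_le (Rbar_mult lam dpsi0) y ->
  (forall z, local_minimizer (F psi lam y) z <-> z = r) /\
  global_minimizer (F psi lam y) r.
Proof.
intros H Hl Hm Hroot Hy. assert (Hroot' := Hroot).
destruct Hroot' as [Hr [Hgt [Hlt Heq]]]. assert (Hm0 := proj1 Hm).
assert (Hlt' : forall w, 0 < w -> w < r -> level (Derive psi) lam w < y).
{ intros w W1 W2. destruct (Rle_lt_dec m w) as [L|L]; [auto|].
  apply (level_lt_before_turning psi dpsi0 lam m y w H Hl Hm Hy); lra. }
assert (G : global_minimizer (F psi lam y) r).
{ split; [lra|]. intros x Hx. destruct (Rle_lt_dec r x) as [L|L].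
  - apply (F_increasing_after_root psi dpsi0 lam m y r x); auto; lra.
  - apply Rlt_le, (F_decreasing psi dpsi0); [exact H|exact Hx|exact L|].
    intros w Hw. apply Hlt'; lra. }
split; [|exact G]. intros z. split.
- intros Hz. destruct (local_minimizer_cases psi dpsi0 lam m y r z H Hm Hroot Hz) as [E|E];
    [|exact E].
  subst z. destruct (Rle_lt_or_eq_dec 0 r ltac:(lra)) as [P|P]; [|exact P].
  exfalso. revert Hz. apply (not_local_minimizer_right psi dpsi0 lam y 0 r H P).
  intros w Hw. apply Hlt'; lra.
- intros ->. apply global_minimizer_local, G.
Qed.

(** * Global minimizers *)

Definition ratio (psi : R -> R) (lam z : R) : R := z / 2 + lam * psi z / z.

Lemma F_sub_F0 (psi : R -> R) (dpsi0 : Rbar) (lam y z : R) :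
  admissible_penalty psi dpsi0 -> 0 < z ->
  F psi lam y z - F psi lam y 0 = z * (ratio psi lam z - y).
Proof.
intros H Hz. unfold F, ratio. rewrite (pen_0 _ _ H). field. lra.
Qed.

Lemma F_lt_F0 (psi : R -> R) (dpsi0 : Rbar) (lam y z : R) :
  admissible_penalty psi dpsi0 -> 0 < z ->
  ratio psi lam z < y <-> F psi lam y z < F psi lam y 0.
Proof.
intros H Hz. assert (E := F_sub_F0 psi dpsi0 lam y z H Hz). split; intros K; nra.
Qed.

Lemma F0_lt_F (psi : R -> R) (dpsi0 : Rbar) (lam y z : R) :
  admissible_penalty psi dpsi0 -> 0 < z ->
  y < ratio psi lam z <-> F psi lam y 0 < F psi lam y z.
Proof.
intros H Hz. assert (E := F_sub_F0 psi dpsi0 lam y z H Hz). split; intros K; nra.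
Qed.

Lemma ratio_ge (psi : R -> R) (dpsi0 : Rbar) (lam z : R) :
  admissible_penalty psi dpsi0 -> 0 < lam -> 0 < z -> z / 2 <= ratio psi lam z.
Proof.
intros H Hl Hz. unfold ratio.
assert (K := pen_ge0 _ _ H z ltac:(lra)).
assert (0 <= lam * psi z / z); [|lra].
apply Rdiv_le_0_compat; [|exact Hz]. apply Rmult_le_pos; lra.
Qed.

Lemma ratio_continuous (psi : R -> R) (dpsi0 : Rbar) (lam z : R) :
  admissible_penalty psi dpsi0 -> 0 < z -> continuous (ratio psi lam) z.
Proof.
intros H Hz. apply (ex_derive_continuous (ratio psi lam) z). unfold ratio.
auto_derive. split; [|lra].
exists (Derive psi z). apply (penalty_is_derive psi dpsi0 z H Hz).
Qed.

(** The ratio stays away from [T] both near [0] and at infinity, so the infimum is a minimum over a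
    compact interval. *)
Lemma ratio_inf_attained (psi : R -> R) (dpsi0 : Rbar) (lam T : R) :
  admissible_penalty psi dpsi0 -> 0 < lam ->
  inf_pos (ratio psi lam) T -> Rbar_lt T (Rbar_mult lam dpsi0) ->
  exists z, 0 < z /\ ratio psi lam z = T.
Proof.
intros H Hl [Hlow Hs] HT.
assert (exists c, T < c /\ Rbar_lt c (Rbar_mult lam dpsi0)) as [c [C1 C2]].
{ destruct (Rbar_mult lam dpsi0) as [b| |]; simpl in HT |- *.
  - exists ((T + b) / 2). lra.
  - exists (T + 1). split; [lra|exact I].
  - destruct HT. }
destruct (level_gt_near_0 psi dpsi0 lam c H Hl C2) as [d [Pd Hd]].
(* With [y = c], [F] increases on the interval from [0] to [d], which is the claim in terms of the
   ratio. *)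
assert (Near : forall z, 0 < z < d -> c < ratio psi lam z).
{ intros z Hz. apply (F0_lt_F psi dpsi0 lam c z H); [lra|].
  apply (F_increasing psi dpsi0); [exact H|lra|lra|]. intros w Hw. apply Hd; lra. }
(* Beyond [2 * T + 2] the bound [z / 2] already exceeds [T + 1]. *)
set (M := Rmax d (2 * T + 2)).
assert (M1 : d <= M) by apply Rmax_l. assert (M2 : 2 * T + 2 <= M) by apply Rmax_r.
destruct (continuity_ab_min (ratio psi lam) (d / 2) M) as [z [Z1 Z2]]; [lra| |].
{ intros x Hx. apply continuity_pt_filterlim. apply (ratio_continuous psi dpsi0); [exact H|lra]. }
exists z. split; [lra|]. apply Rle_antisym; [|apply Hlow; lra].
destruct (Rle_lt_dec (ratio psi lam z) T) as [L|L]; [exact L|].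
(* A number above [T] that bounds the ratio from below in all three regions: near [0], in the
   compact part, and beyond [M]. *)
set (e := Rmin (Rmin c (ratio psi lam z)) (T + 1)).
assert (E1 : e <= c) by (apply Rle_trans with (2 := Rmin_l c (ratio psi lam z)); apply Rmin_l).
assert (E2 : e <= ratio psi lam z)
  by (apply Rle_trans with (2 := Rmin_r c (ratio psi lam z)); apply Rmin_l).
assert (E3 : e <= T + 1) by apply Rmin_r.
destruct (Hs e) as [w [W1 W2]].
{ repeat apply Rmin_glb_lt; lra. }
destruct (Rlt_le_dec w d) as [Q|Q].
- assert (A := Near w ltac:(lra)). lra.
- destruct (Rle_lt_dec w M) as [Q'|Q'].
  + assert (A := Z1 w ltac:(lra)). lra.
  + assert (A := ratio_ge psi dpsi0 lam w H Hl W1). lra.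
Qed.

(** If some ratio were below [tau], take it as [y]: then [F] increases strictly from [0], yet
    [F z = F 0] at the point in question. *)
Lemma tau_le_global_threshold (psi : R -> R) (dpsi0 : Rbar) (lam tau T : R) :
  admissible_penalty psi dpsi0 -> 0 < lam ->
  inf_pos (level (Derive psi) lam) tau ->
  inf_pos (ratio psi lam) T -> tau <= T.
Proof.
intros H Hl Ht [Hlow Hs]. destruct (Rle_lt_dec tau T) as [L|L]; [exact L|exfalso].
destruct (Hs tau L) as [z [Hz1 Hz2]].
assert (K := F_increasing psi dpsi0 lam (ratio psi lam z) 0 z H ltac:(lra) Hz1
  ltac:(intros w Hw; apply (gt_of_lt_inf_pos _ tau _ Ht); lra)).
apply (F0_lt_F psi dpsi0 lam _ z H Hz1) in K. lra.
Qed.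

Lemma zero_unique_global_minimizer (psi : R -> R) (dpsi0 : Rbar) (lam T y : R) :
  admissible_penalty psi dpsi0 -> inf_pos (ratio psi lam) T -> y < T ->
  forall z, global_minimizer (F psi lam y) z <-> z = 0.
Proof.
intros H HT Hy.
assert (K : forall x, 0 < x -> F psi lam y 0 < F psi lam y x).
{ intros x Hx. apply (F0_lt_F psi dpsi0 lam y x H Hx).
  apply (gt_of_lt_inf_pos _ T y HT Hy x Hx). }
intros z. split.
- intros [[Hz|Hz] G]; [|auto]. assert (A := K z Hz). assert (A' := G 0 ltac:(lra)). lra.
- intros ->. split; [lra|]. intros x [Hx|<-]; [|lra]. apply Rlt_le, K, Hx.
Qed.

(** For a [y] strictly between the limit and [T], the positive root would be a global minimizer
    although [0] is the only one. *)
Lemma global_threshold_le_limit (psi : R -> R) (dpsi0 : Rbar) (lam m tau T : R) :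
  admissible_penalty psi dpsi0 -> 0 < lam ->
  turning_point (level (Derive psi) lam) m ->
  inf_pos (level (Derive psi) lam) tau ->
  inf_pos (ratio psi lam) T -> Rbar_le T (Rbar_mult lam dpsi0).
Proof.
intros H Hl Hm Ht HT. apply Rbar_not_lt_le. intros K.
assert (Ktau := tau_le_limit psi dpsi0 lam m tau H Hl Hm Ht).
destruct (Rbar_mult lam dpsi0) as [b| |] eqn:E; simpl in K, Ktau; [|exact K|exact Ktau].
set (y := (b + T) / 2).
assert (Y1 : b < y) by (unfold y; lra). assert (Y2 : y < T) by (unfold y; lra).
destruct (upper_root_exists (level (Derive psi) lam) m tau y) as [r Hr]; auto; [| |lra|].
{ intros z. apply (penalty_level_continuous psi dpsi0 lam z H). }
{ intros z. apply (penalty_level_ge psi dpsi0 lam z H Hl). }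
destruct (root_minimizer_of_limit_le psi dpsi0 lam m y r H Hl Hm Hr) as [_ G].
{ rewrite E. simpl. lra. }
apply (zero_unique_global_minimizer psi dpsi0 lam T y H HT Y2) in G.
assert (A := upper_root_pos _ m tau y r Ht Hr (proj1 Hm) ltac:(lra)). lra.
Qed.

Lemma global_minimizer_above_threshold (psi : R -> R) (dpsi0 : Rbar) (lam m T y r : R) :
  admissible_penalty psi dpsi0 ->
  turning_point (level (Derive psi) lam) m ->
  inf_pos (ratio psi lam) T ->
  upper_root (level (Derive psi) lam) m y r -> T < y ->
  forall z, global_minimizer (F psi lam y) z <-> z = r.
Proof.
intros H Hm [Hlow Hs] Hr Hy. destruct (Hs y Hy) as [x [X1 X2]].
apply (F_lt_F0 psi dpsi0 lam y x H X1) in X2.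
assert (K : F psi lam y r < F psi lam y 0).
{ destruct (F_ge_min psi dpsi0 lam m y r x H Hm Hr) as [A|A]; lra. }
intros z. split.
- intros G. destruct (local_minimizer_cases psi dpsi0 lam m y r z H Hm Hr
    (global_minimizer_local _ _ G)) as [E|E]; [|exact E].
  subst z. assert (A := proj2 G x ltac:(lra)). lra.
- intros ->. split; [assert (A := proj1 Hm); assert (A' := proj1 Hr); lra|].
  intros w Hw. destruct (F_ge_min psi dpsi0 lam m y r w H Hm Hr Hw); lra.
Qed.

Lemma global_minimizer_at_threshold (psi : R -> R) (dpsi0 : Rbar) (lam m T r : R) :
  admissible_penalty psi dpsi0 -> 0 < lam ->
  turning_point (level (Derive psi) lam) m ->
  inf_pos (ratio psi lam) T ->
  upper_root (level (Derive psi) lam) m T r ->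
  forall z, global_minimizer (F psi lam T) z <-> z = 0 \/ z = r.
Proof.
intros H Hl Hm HT Hr.
assert (G0 : global_minimizer (F psi lam T) 0).
{ split; [lra|]. intros x [Hx|<-]; [|lra].
  assert (E := F_sub_F0 psi dpsi0 lam T x H Hx).
  assert (K := proj1 HT x Hx). nra. }
assert (Gr : global_minimizer (F psi lam T) r).
(* Below the limit, a point attaining the infimum is a second global minimizer and must be the root.
   At the limit the infimum need not be attained, but there the root is the only local minimizer, so
   it coincides with [0]. *)
{ destruct (Rbar_lt_dec T (Rbar_mult lam dpsi0)) as [K|K].
  - destruct (ratio_inf_attained psi dpsi0 lam T H Hl HT K) as [x [X1 X2]].
    assert (E := F_sub_F0 psi dpsi0 lam T x H X1). rewrite X2 in E.
    assert (Gx : global_minimizer (F psi lam T) x).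
    { split; [lra|]. intros w Hw. assert (A := proj2 G0 w Hw). lra. }
    destruct (local_minimizer_cases psi dpsi0 lam m T r x H Hm Hr
      (global_minimizer_local _ _ Gx)) as [A|A]; [lra|]. subst x. exact Gx.
  - apply Rbar_not_lt_le in K.
    apply (root_minimizer_of_limit_le psi dpsi0 lam m T r H Hl Hm Hr K). }
intros z. split.
- intros G. apply (local_minimizer_cases psi dpsi0 lam m T r z H Hm Hr).
  apply global_minimizer_local, G.
- intros [->| ->]; assumption.
Qed.

(** * Continuity and monotonicity of the root *)

Lemma affine_pos_locally (A B C : R) (q0 : R * R) :
  0 < A + B * fst q0 + C * snd q0 ->
  locally q0 (fun q : R * R => 0 < A + B * fst q + C * snd q).
Proof.
intros H.
assert (K : continuous (fun q : R * R => A + B * fst q + C * snd q) q0).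
{ apply (continuous_plus (fun q : R * R => A + B * fst q) (fun q => C * snd q)).
  - apply (continuous_plus (fun q : R * R => A) (fun q => B * fst q)).
    + apply continuous_const.
    + apply (continuous_scal_r B (fun q : R * R => fst q)). apply continuous_fst.
  - apply (continuous_scal_r C (fun q : R * R => snd q)). apply continuous_snd. }
apply K. apply (open_gt 0). exact H.
Qed.

(* All estimates are made at fixed points [z], where [level p lam z] is affine
   in [lam]; hence no uniformity in [z] is needed. *)
Lemma upper_root_continuous (p : R -> R) (D : R * R -> Prop) (m : R -> R) (rho : R -> R -> R) :
  (forall q, D q -> 0 < fst q /\ turning_point (level p (snd q)) (m (snd q))) ->
  (forall q, D q -> upper_root (level p (snd q)) (m (snd q)) (fst q) (rho (fst q) (snd q))) ->
  continuous_on D (fun q => rho (fst q) (snd q)).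
Proof.
intros Hm Hr.
change (forall q0 : R * R, D q0 ->
  filterlim (fun q : R * R => rho (fst q) (snd q)) (within D (locally q0))
    (locally (rho (fst q0) (snd q0)))).
intros q0 D0.
destruct (Hm q0 D0) as [_ [M0 [Md0 Mi0]]]. assert (R0 := Hr q0 D0).
set (r0 := rho (fst q0) (snd q0)) in *. destruct R0 as [Rm0 [Rgt0 [Rlt0 Req0]]].
assert (Up : forall e, 0 < e ->
  within D (locally q0) (fun q : R * R => rho (fst q) (snd q) < r0 + e)).
{ intros e Pe. unfold within.
  assert (K1 := Rgt0 (r0 + e) ltac:(lra)).
  (* The increase from [r0 + e / 2] to [r0 + e] persists for nearby [lam] and keeps their turning
     points at or below [r0 + e]; no continuity of [m] has to be known. *)
  assert (K2 := Mi0 (r0 + e / 2) (r0 + e) ltac:(lra) ltac:(lra) ltac:(lra)).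
  assert (L1 := affine_pos_locally (r0 + e) (-1) (p (r0 + e)) q0
    ltac:(unfold level in K1; lra)).
  assert (L2 := affine_pos_locally (e / 2) 0 (p (r0 + e) - p (r0 + e / 2)) q0
    ltac:(unfold level in K2; lra)).
  generalize (filter_and _ _ L1 L2). apply filter_imp.
  intros q [Q1 Q2] Dq. change (R * R)%type in (type of q).
  destruct (Hm q Dq) as [_ [M [Md Mi]]]. destruct (Hr q Dq) as [Rm [Rgt [Rlt Req]]].
  set (r := rho (fst q) (snd q)) in *.
  assert (E1 : fst q < level p (snd q) (r0 + e)) by (unfold level; lra).
  assert (E2 : level p (snd q) (r0 + e / 2) < level p (snd q) (r0 + e)) by (unfold level; lra).
  assert (Mle : m (snd q) <= r0 + e).
  { destruct (Rle_lt_dec (m (snd q)) (r0 + e)) as [L|L]; [exact L|].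
    assert (A := Md (r0 + e / 2) (r0 + e) ltac:(lra) ltac:(lra) ltac:(lra)). lra. }
  destruct (Rlt_le_dec r (r0 + e)) as [L|[L|L]]; [exact L| |].
  - assert (A := Rlt (r0 + e) ltac:(lra) Mle L). lra.
  - assert (A := Req ltac:(lra)). rewrite <- L in A. lra. }
assert (Down : forall e, 0 < e ->
  within D (locally q0) (fun q : R * R => r0 - e < rho (fst q) (snd q))).
{ intros e Pe. unfold within.
  destruct (Rlt_le_dec (r0 - e) 0) as [Neg|Pos].
  { apply filter_forall. intros q Dq. destruct (Hm q Dq) as [_ [M _]].
    destruct (Hr q Dq) as [Rm _]. lra. }
  destruct Rm0 as [Rm0|Rm0].
  - set (a := Rmax (m (snd q0)) (r0 - e / 2)).
    assert (A1 : m (snd q0) <= a) by apply Rmax_l.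
    assert (A2 : r0 - e / 2 <= a) by apply Rmax_r.
    assert (A3 : a < r0) by (apply Rmax_lub_lt; lra).
    assert (K1 := Rlt0 a ltac:(lra) A1 A3).
    assert (L1 := affine_pos_locally (- a) 1 (- p a) q0 ltac:(unfold level in K1; lra)).
    revert L1. apply filter_imp. intros q Q1 Dq. change (R * R)%type in (type of q).
    destruct (Hr q Dq) as [Rm [Rgt [Rlt Req]]].
    set (r := rho (fst q) (snd q)) in *.
    assert (E1 : level p (snd q) a < fst q) by (unfold level; lra).
    destruct (Rlt_le_dec (r0 - e) r) as [L|L]; [exact L|].
    assert (A := Rgt a ltac:(lra)). lra.
  (* The root is the turning point, so no smaller point of the increasing branch is available.
     Instead, the decrease from [a] to [r0] persists and forces nearby turning points, hence nearby
     roots, beyond [a]. *)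
  - set (a := r0 - e / 2).
    assert (K1 := Md0 a r0 ltac:(unfold a; lra) ltac:(unfold a; lra) ltac:(lra)).
    assert (L1 := affine_pos_locally (a - r0) 0 (p a - p r0) q0 ltac:(unfold level in K1; lra)).
    revert L1. apply filter_imp. intros q Q1 Dq. change (R * R)%type in (type of q).
    destruct (Hm q Dq) as [_ [M [Md Mi]]]. destruct (Hr q Dq) as [Rm _].
    assert (E1 : level p (snd q) r0 < level p (snd q) a) by (unfold level; lra).
    destruct (Rlt_le_dec a (m (snd q))) as [L|L]; [unfold a in *; lra|].
    assert (A := Mi a r0 ltac:(unfold a; lra) L ltac:(unfold a; lra)). lra. }
intros P [d Hd]. unfold filtermap.
generalize (filter_and _ _ (Up d (cond_pos d)) (Down d (cond_pos d))).
apply filter_imp. intros q [Q1 Q2]. apply Hd.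
change (Rabs (rho (fst q) (snd q) - r0) < d). apply Rabs_def1; lra.
Qed.

Lemma upper_root_mono (g : R -> R) (m y1 y2 r1 r2 : R) :
  0 <= m -> upper_root g m y1 r1 -> upper_root g m y2 r2 -> y1 <= y2 -> r1 <= r2.
Proof.
intros Hm [A1 [B1 [C1 D1]]] [A2 [B2 [C2 D2]]] Hy.
destruct (Rle_lt_dec r1 r2) as [L|L]; [exact L|].
assert (K := B2 r1 L). assert (K' := D1 ltac:(lra)). lra.
Qed.

(** As [p] is nonnegative, a larger [lam] raises the level pointwise, so beyond [r1] the second
    level exceeds [y] as well. *)
Lemma upper_root_antitone (p : R -> R) (lam1 lam2 m1 m2 y r1 r2 : R) :
  (forall z, 0 < z -> 0 <= p z) -> 0 <= m1 -> lam1 <= lam2 ->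
  upper_root (level p lam1) m1 y r1 -> upper_root (level p lam2) m2 y r2 -> r2 <= r1.
Proof.
intros Hp Hm Hlam [A1 [B1 [C1 D1]]] [A2 [B2 [C2 D2]]].
destruct (Rle_lt_dec r2 r1) as [L|L]; [exact L|].
assert (K := B1 r2 L). assert (K' := D2 ltac:(lra)).
assert (P := Hp r2 ltac:(lra)). unfold level in K, K'. nra.
Qed.

(** * Choice of the four functions and assembly of the three transitions *)

Theorem mainTheorem1 (psi : R -> R) (dpsi0 : Rbar)
    (Hpsi : admissible_penalty psi dpsi0) :
  exists (m tau T : R -> R) (rho : R -> R -> R),
    (forall lam : R, 0 < lam ->
       (* (i) *)
       (0 <= m lam /\
        forall y, 0 < y ->
          strictly_concave_on (fun z => 0 <= z <= m lam) (F psi lam y) /\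
          convex_on (fun z => m lam <= z) (F psi lam y)) /\
       (* (ii) *)
       ((forall y, 0 < y ->
           exists a b, forall z,
             local_minimizer (F psi lam y) z -> z = a \/ z = b) /\
        (forall y, 0 < y -> y < tau lam ->
           (forall z, local_minimizer (F psi lam y) z <-> z = 0) /\
           global_minimizer (F psi lam y) 0) /\
        (forall y, 0 < y -> tau lam < y ->
           Rbar_lt y (Rbar_mult lam dpsi0) ->
           rho y lam <> 0 /\
           forall z, local_minimizer (F psi lam y) z <->
                     z = 0 \/ z = rho y lam) /\
        (* degenerate case: rho is then a stationary inflection point of F *)
        (forall y, 0 < y -> y = tau lam ->
           Rbar_lt y (Rbar_mult lam dpsi0) ->
           rho y lam <> 0 /\
           is_derive (F psi lam y) (rho y lam) 0 /\
           forall z, local_minimizer (F psi lam y) z <-> z = 0) /\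
        (forall y, 0 < y -> Rbar_le (Rbar_mult lam dpsi0) y ->
           (forall z, local_minimizer (F psi lam y) z <-> z = rho y lam) /\
           global_minimizer (F psi lam y) (rho y lam)) /\
        Finite (tau lam) =
          Rbar_plus (m lam) (Rbar_mult lam (pen_deriv psi dpsi0 (m lam))) /\
        (forall y, 0 < y -> tau lam <= y -> m lam <= rho y lam) /\
        (forall y, 0 < y -> tau lam < y -> 0 < rho y lam) /\
        (Rbar_lt (tau lam) (Rbar_mult lam dpsi0) -> 0 < m lam)) /\
       (* (iii) *)
       (tau lam <= T lam /\ Rbar_le (T lam) (Rbar_mult lam dpsi0) /\
        (forall y, 0 < y -> y < T lam ->
           forall z, global_minimizer (F psi lam y) z <-> z = 0) /\
        (forall y, 0 < y -> y = T lam ->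
           forall z, global_minimizer (F psi lam y) z <->
                     z = 0 \/ z = rho y lam) /\
        (forall y, 0 < y -> T lam < y ->
           forall z, global_minimizer (F psi lam y) z <-> z = rho y lam))) /\
    (* (ii), continuity and variations of rho *)
    continuous_on
      (fun p : R * R => 0 < fst p /\ 0 < snd p /\ tau (snd p) <= fst p)
      (fun p : R * R => rho (fst p) (snd p)) /\
    (forall lam y1 y2, 0 < lam -> 0 < y1 -> tau lam <= y1 -> y1 <= y2 ->
       rho y1 lam <= rho y2 lam) /\
    (forall y lam1 lam2, 0 < y -> 0 < lam1 -> lam1 <= lam2 ->
       tau lam1 <= y -> tau lam2 <= y ->
       rho y lam2 <= rho y lam1).
Proof.
set (g := level (Derive psi)).
assert (Hc : forall lam z, 0 < z -> continuous (g lam) z).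
{ intros lam z. apply (penalty_level_continuous psi dpsi0 lam z Hpsi). }
assert (Hge : forall lam, 0 < lam -> forall z, 0 < z -> z <= g lam z).
{ intros lam Hl z. apply (penalty_level_ge psi dpsi0 lam z Hpsi Hl). }
(* Existence is known for each parameter separately; choice turns it into functions. They are
   meaningful only for [lam > 0], and for [rho] only when [tau lam <= y]. *)
set (m := fun lam => epsilon (inhabits 0) (turning_point (g lam))).
set (tau := fun lam => epsilon (inhabits 0) (inf_pos (g lam))).
set (T := fun lam => epsilon (inhabits 0) (inf_pos (ratio psi lam))).
set (rho := fun y lam => epsilon (inhabits 0) (upper_root (g lam) (m lam) y)).
assert (Hm : forall lam, 0 < lam -> turning_point (g lam) (m lam)).
{ intros lam Hl. apply epsilon_spec, turning_point_exists; auto.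
  apply (penalty_level_convex psi dpsi0 lam Hpsi Hl). }
assert (Ht : forall lam, 0 < lam -> inf_pos (g lam) (tau lam)).
{ intros lam Hl. apply epsilon_spec, inf_pos_exists.
  intros z Hz. assert (K := Hge lam Hl z Hz). lra. }
assert (HT : forall lam, 0 < lam -> inf_pos (ratio psi lam) (T lam)).
{ intros lam Hl. apply epsilon_spec, inf_pos_exists.
  intros z Hz. assert (K := ratio_ge psi dpsi0 lam z Hpsi Hl Hz). lra. }
assert (Hr : forall lam y, 0 < lam -> tau lam <= y ->
  upper_root (g lam) (m lam) y (rho y lam)).
{ intros lam y Hl Hy. apply epsilon_spec, (upper_root_exists _ _ (tau lam)); auto. }
clearbody m tau T rho.
exists m, tau, T, rho. split; [|split; [|split]].
- intros lam Hl.
  assert (Hml := Hm lam Hl). assert (Htl := Ht lam Hl). assert (HTl := HT lam Hl).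
  assert (Hrl := fun y => Hr lam y Hl). assert (Hm0 := proj1 Hml).
  assert (HtT := tau_le_global_threshold psi dpsi0 lam _ _ Hpsi Hl Htl HTl).
  split; [|split].
  + split; [exact Hm0|]. intros y _. split.
    * apply (F_strictly_concave psi dpsi0); assumption.
    * apply (F_convex psi dpsi0); assumption.
  + assert (Low : forall y, y < tau lam ->
      (forall z, local_minimizer (F psi lam y) z <-> z = 0) /\
      global_minimizer (F psi lam y) 0).
    (* Strictly below [tau] no positive point is exceptional, and [0] is a dummy for [z0]. *)
    { intros y Hy. apply (zero_minimizer_of_level_gt psi dpsi0 lam y 0 Hpsi).
      intros z Hz _. apply (gt_of_lt_inf_pos _ _ _ Htl Hy z Hz). }
    assert (Mpos : Rbar_lt (tau lam) (Rbar_mult lam dpsi0) -> 0 < m lam)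
      by exact (turning_pos_of_tau_lt psi dpsi0 lam _ _ Hpsi Hl Hml Htl).
    repeat match goal with |- _ /\ _ => split end.
    * intros y _. exists 0, (rho y lam). intros z Hz.
      destruct (Rlt_le_dec y (tau lam)) as [L|L].
      -- left. apply (proj1 (Low y L)), Hz.
      -- apply (local_minimizer_cases psi dpsi0 lam (m lam) y _ z Hpsi Hml (Hrl y L) Hz).
    * intros y _. apply Low.
    * intros y _ Hy Hlim.
      assert (Ry := Hrl y ltac:(lra)).
      assert (P := upper_root_pos _ _ _ y _ Htl Ry Hm0 Hy).
      split; [lra|]. intros z. split.
      -- apply (local_minimizer_cases psi dpsi0 lam (m lam) y _ z Hpsi Hml Ry).
      -- intros [->| ->].
         ++ apply (zero_local_minimizer psi dpsi0 lam y Hpsi Hl Hlim).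
         ++ apply (root_local_minimizer psi dpsi0 lam _ _ y _ Hpsi Hml Htl Ry Hy).
    * intros y _ Hy Hlim. subst y. assert (P := Mpos Hlim).
      assert (Ry := Hrl (tau lam) ltac:(lra)).
      assert (Pr : 0 < rho (tau lam) lam) by (assert (A := proj1 Ry); lra).
      split; [lra|]. split.
      -- assert (E : g lam (rho (tau lam) lam) - tau lam = 0).
         { destruct Ry as [_ [_ [_ E]]]. rewrite E; [ring|exact Pr]. }
         rewrite <- E. apply (F_is_derive psi dpsi0 lam _ _ Hpsi Pr).
      (* At [y = tau] the level touches [y] at the turning point only. *)
      -- apply (zero_minimizer_of_level_gt psi dpsi0 lam _ (m lam) Hpsi).
         intros z Hz Nz. rewrite (inf_pos_turning_point _ _ _ Hml Htl P).
         destruct Hml as [_ [Hd Hi]].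
         destruct (Rtotal_order z (m lam)) as [L|[L|L]]; [|contradiction|].
         ++ apply Hd; lra.
         ++ apply Hi; lra.
    * intros y _ Hlim. apply (root_minimizer_of_limit_le psi dpsi0 lam (m lam)); auto.
      apply Hrl.
      exact (Rbar_le_trans (tau lam) _ y
        (tau_le_limit psi dpsi0 lam _ _ Hpsi Hl Hml Htl) Hlim).
    * apply (tau_eq psi dpsi0); assumption.
    * intros y _ Hy. apply (Hrl y Hy).
    * intros y _ Hy. apply (upper_root_pos _ _ _ y _ Htl (Hrl y ltac:(lra)) Hm0 Hy).
    * exact Mpos.
  + split; [exact HtT|]. split.
    { apply (global_threshold_le_limit psi dpsi0 lam (m lam) (tau lam)); assumption. }
    split; [|split].
    * intros y _ Hy. apply (zero_unique_global_minimizer psi dpsi0 lam (T lam) y Hpsi HTl Hy).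
    * intros y _ ->. apply (global_minimizer_at_threshold psi dpsi0 lam (m lam)); auto.
    * intros y _ Hy.
      apply (global_minimizer_above_threshold psi dpsi0 lam (m lam) (T lam)); auto.
      apply Hrl. lra.
- apply (upper_root_continuous (Derive psi) _ m rho).
  + intros q [Q1 [Q2 Q3]]. split; [exact Q1|]. apply (Hm (snd q) Q2).
  + intros q [Q1 [Q2 Q3]]. apply (Hr (snd q) (fst q) Q2 Q3).
- intros lam y1 y2 Hl _ Hy1 Hy12.
  apply (upper_root_mono (g lam) (m lam) y1 y2); auto.
  + apply (Hm lam Hl).
  + apply Hr; lra.
- intros y lam1 lam2 _ Hl1 Hl12 Hy1 Hy2.
  apply (upper_root_antitone (Derive psi) lam1 lam2 (m lam1) (m lam2) y); auto.
  + intros z. apply (penalty_deriv_ge0 psi dpsi0 z Hpsi).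
  + apply (Hm lam1 Hl1).
  + apply (Hr lam2 y); lra.
Qed.
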